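(* Assume all $\lambda_k>0$ and $\mu_k>0$. Let $\mu_{\min}=\min_k\mu_k$, $\mu_{\max}=\max_k\mu_k$, $r_\mu=\mu_{\max}/\mu_{\min}$, let $\mu^{\min}$ (resp. $\mu^{\max}$) be the vector with all entries equal to $\mu_{\min}$ (resp. $\mu_{\max}$), and let $C_{m,n}=\{m'\in\mathbb{Z}_+^K: m'_k\ge m_k\ \forall k,\ \sum_km'_k=\sum_km_k+n\}$. Let $\bar X$ be stationary for the two-layer loss system with parameters $(m,n,\lambda,\mu)$, $\bar X(m',0,\lambda,\mu^{\max})$ stationary for the system with parameters $(m',0,\lambda,\mu^{\max})$, and $\bar X^{\mathrm{mp}}(m,n,\lambda,\mu^{\min})$ stationary for the maximum packing system with parameters $(m,n,\lambda,\mu^{\min})$. Then for every $m'\in C_{m,n}$, $|\bar X(m',0,\lambda,\mu^{\max})|\le_{\mathrm{st}}|\bar X|\le_{\mathrm{st}}|\bar X^{\mathrm{mp}}(m,n,\lambda,\mu^{\min})|$. Consequently, writing $a=\mathbb{E}|\bar X|$, $\theta$ for the mean throughput and $b$ for the overall blocking probability (with corresponding quantities for the other systems indicated by their parameters and superscript mp): $\max_{m'\in C_{m,n}}a(m',0,\lambda,\mu^{\max})\le a\le a^{\mathrm{mp}}(m,n,\lambda,\mu^{\min})$; $\max_{m'\in C_{m,n}}r_\mu^{-1}\theta(m',0,\lambda,\mu^{\max})\le\theta\le r_\mu\,\theta^{\mathrm{mp}}(m,n,\lambda,\mu^{\min})$; $1-r_\mu\big(1-b^{\mathrm{mp}}(m,n,\lambda,\mu^{\min})\big)\le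 b\le\min_{m'\in C_{m,n}}\big(1-r_\mu^{-1}(1-b(m',0,\lambda,\mu^{\max}))\big)$.
   Context: Two-layer loss system with parameters $(m,n,\lambda,\mu)$ ($m\in\mathbb{Z}_+^K$ layer-1 servers dedicated per class, $n$ shared layer-2 servers, arrival rates $\lambda_k$, service rates $\mu_k$): Markov process on $S=\{x\in\mathbb{Z}_+^K\times\mathbb{Z}_+^K:x_{1,k}\le m_k\ \forall k,\ \sum_kx_{2,k}\le n\}$ with transitions $x\mapsto x+e_{1,k}$ at rate $\lambda_k1(x_{1,k}<m_k)$, $x\mapsto x+e_{2,k}$ at rate $\lambda_k1(x_{1,k}=m_k,\sum_lx_{2,l}<n)$, $x\mapsto x-e_{i,k}$ at rate $\mu_kx_{i,k}$. The maximum packing system has the same arrival transitions but departures $x\mapsto x-e_{1,k}$ at rate $\mu_kx_{1,k}1(x_{2,k}=0)$ and $x\mapsto x-e_{2,k}$ at rate $\mu_kx_{1,k}1(x_{2,k}>0)+\mu_kx_{2,k}$. Each of these processes has a unique stationary distribution. $|x|=\sum_{i,k}x_{i,k}$. For a system with stationary state $\bar X$: $a_k=\mathbb{E}(\bar X_{1,k}+\bar X_{2,k})$, $\theta_k=\mu_ka_k$, $\theta=\sum_k\theta_k$, $a=\sum_ka_k$, $b_k=P(\bar X\in B_k)$ with $B_k=\{x:x_{1,k}=m_k,\sum_lx_{2,l}=n\}$, and the overall blocking probability $b$ is defined by $(\sum_k\lambda_k)(1-b)=\theta$, i.e. $b=\sum_k\lambda_kb_k/\sum_k\lambda_k$. $\le_{\mathrm{st}}$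 is the usual stochastic order of real random variables. *)

(* Defs.v *)
From HB Require Import structures.
From mathcomp Require Import all_boot all_order all_algebra.
Set Implicit Arguments. Unset Strict Implicit. Unset Printing Implicit Defensive.
Import Order.TTheory GRing.Theory Num.Theory.
Local Open Scope ring_scope.

(* States: pairs (x_1, x_2) of vectors indexed by the K classes, with entries
   bounded by N (N is chosen large enough that S is contained in the type). *)
Notation state K N :=
  ({ffun 'I_K -> 'I_N.+1} * {ffun 'I_K -> 'I_N.+1})%type.

Definition Nb {K} (m : 'I_K -> nat) (n : nat) : nat := (\sum_k m k + n)%N.

Definition x1 {K N} (x : state K N) (k : 'I_K) : nat := x.1 k.
Definition x2 {K N} (x : state K N) (k : 'I_K) : nat := x.2 k.

Definition st_size {K N} (x : state K N) : nat := (\sum_k (x1 x k + x2 x k))%N.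
Definition st_sizeR {R : numDomainType} {K N} (x : state K N) : R := (st_size x)%:R.

Definition inS {K N} (m : 'I_K -> nat) (n : nat) (x : state K N) : bool :=
  [forall k, (x1 x k <= m k)%N] && (\sum_k x2 x k <= n)%N.

Definition up1 {K N} (k : 'I_K) (x y : state K N) : bool :=
  [forall l, (x1 y l == x1 x l + (l == k))%N && (x2 y l == x2 x l)].
Definition up2 {K N} (k : 'I_K) (x y : state K N) : bool :=
  [forall l, (x1 y l == x1 x l) && (x2 y l == x2 x l + (l == k))%N].

Definition b2R {R : numDomainType} (b : bool) : R := if b then 1 else 0.

Definition arr_rate {R : numDomainType} {K N} (m : 'I_K -> nat) (n : nat)
  (lam : 'I_K -> R) (x y : state K N) : R :=
  \sum_k lam k *
    (b2R (up1 k x y && (x1 x k < m k)%N)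
     + b2R ([&& up2 k x y, x1 x k == m k & (\sum_l x2 x l < n)%N])).

Definition loss_rate {R : numDomainType} {K N} (m : 'I_K -> nat) (n : nat)
  (lam mu : 'I_K -> R) (x y : state K N) : R :=
  arr_rate m n lam x y
  + \sum_k mu k * (b2R (up1 k y x) * (x1 x k)%:R + b2R (up2 k y x) * (x2 x k)%:R).

Definition mp_rate {R : numDomainType} {K N} (m : 'I_K -> nat) (n : nat)
  (lam mu : 'I_K -> R) (x y : state K N) : R :=
  arr_rate m n lam x y
  + \sum_k mu k * (b2R (up1 k y x && (x2 x k == 0)%N) * (x1 x k)%:R
                   + b2R (up2 k y x) * ((x1 x k * (0 < x2 x k))%N%:R + (x2 x k)%:R)).

Definition stationary {R : numDomainType} {T : finType} (q : T -> T -> R)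
  (S : pred T) (pi : T -> R) : Prop :=
  [/\ forall x, 0 <= pi x,
      forall x, ~~ S x -> pi x = 0,
      \sum_x pi x = 1
    & forall x, S x -> \sum_y pi y * q y x = pi x * \sum_y q x y].

Definition stle {R : numDomainType} {T1 T2 : finType} (pi1 : T1 -> R) (X1 : T1 -> R)
  (pi2 : T2 -> R) (X2 : T2 -> R) : Prop :=
  forall t : R, \sum_(x | t < X1 x) pi1 x <= \sum_(y | t < X2 y) pi2 y.

Definition amean_k {R : numDomainType} {K N} (pi : state K N -> R) (k : 'I_K) : R :=
  \sum_x pi x * (x1 x k + x2 x k)%N%:R.
Definition amean {R : numDomainType} {K N} (pi : state K N -> R) : R :=
  \sum_k amean_k pi k.
Definition thr {R : numDomainType} {K N} (mu : 'I_K -> R) (pi : state K N -> R) : R :=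
  \sum_k mu k * amean_k pi k.
Definition inB {K N} (m : 'I_K -> nat) (n : nat) (k : 'I_K) (x : state K N) : bool :=
  (x1 x k == m k) && (\sum_l x2 x l == n)%N.
Definition blk_k {R : numDomainType} {K N} (m : 'I_K -> nat) (n : nat)
  (pi : state K N -> R) (k : 'I_K) : R :=
  \sum_(x | inB m n k x) pi x.
Definition blk {R : numFieldType} {K N} (m : 'I_K -> nat) (n : nat) (lam : 'I_K -> R)
  (pi : state K N -> R) : R :=
  (\sum_k lam k * blk_k m n pi k) / \sum_k lam k.

Definition inC {K} (m : 'I_K -> nat) (n : nat) (m' : 'I_K -> nat) : bool :=
  [forall k, (m k <= m' k)%N] && (\sum_k m' k == \sum_k m k + n)%N.

(* mu_max, mu_min (correct for K >= 1 and positive rates), r_mu *)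
Definition mu_max {R : realDomainType} {K} (mu : 'I_K -> R) : R :=
  \big[Num.max/0]_k mu k.
Definition mu_min {R : realDomainType} {K} (mu : 'I_K -> R) : R :=
  \big[Num.min/mu_max mu]_k mu k.
Definition r_mu {R : realFieldType} {K} (mu : 'I_K -> R) : R := mu_max mu / mu_min mu.

(* Main.v *)
(* Let [L_A], [L_B] be the generators of two systems and let [f] be monotone for
   a relation between their states. The empty state is reachable from every
   state, so by the maximum principle harmonic functions are constant and the
   Poisson equations [L_A g = E_A f - f], [L_B h = E_B f - f] are solvable. At a
   related pair [(x, z)] maximizing [g x - h z] one shows
   [L_A g x <= L_B h z], as a coupling preserving the relation would give;
   hence [E_A f - E_B f <= f x - f z <= 0]. No coupling is constructed and no
   limit in time is taken, so any ordered field will do.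

   The relation is [x_{1,k} <= z_{1,k} + c_k] for all [k] and [|x| <= |z|], where
   the smaller system has [c_k] more dedicated servers in each class and the
   larger one has [sum_k c_k] more shared servers. The lower bound uses
   [c = m' - m], the upper bound [c = 0]. Throughput and blocking follow from the
   flow balance [E (L |X|) = 0]. *)
Require Import Defs.
From HB Require Import structures.
From mathcomp Require Import all_boot all_order all_algebra.
From mathcomp Require Import zify lra.
Import Order.TTheory GRing.Theory Num.Theory.
Local Open Scope ring_scope.
Set Implicit Arguments.
Unset Strict Implicit.
Unset Printing Implicit Defensive.

(** * Finite Markov generators: maximum principle and Poisson equation *)

Section FiniteMarkov.
Context {R : realFieldType} {T : finType}.
Implicit Types (q : T -> T -> R) (g f : T -> R).

Definition generator q g (x : T) : R := \sum_y q x y * (g y - g x).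

Section Poisson.
Variables (q : T -> T -> R) (rk : T -> nat) (x0 : T).
Hypothesis q_ge0 : forall x y, 0 <= q x y.
Hypothesis q_down : forall x, x != x0 -> exists2 y, 0 < q x y & (rk y < rk x)%N.

(** At a maximum point all terms of the generator are nonpositive and sum to zero, so each vanishes.
    A positive rate then carries the maximum value to a state of lower rank, and the descent ends at
    [x0]. *)
Lemma harmonic_le_root g :
  (forall x, generator q g x = 0) -> forall x, g x <= g x0.
Proof.
move=> hg; have [xm _ maxm] := arg_maxP g (erefl : xpredT x0).
suff: forall n x, (rk x <= n)%N -> g xm <= g x -> g xm <= g x0.
  by move=> H x; apply: le_trans (maxm x isT) (H _ xm (leqnn _) (lexx _)).
elim=> [|n IHn] x rkx gx; have [<-//|xx0] := eqVneq x x0;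
  have [y qy rky] := q_down xx0; first by move: rky; lia.
apply: (IHn y); first by lia.
have le0 z : q x z * (g z - g x) <= 0.
  by rewrite mulr_ge0_le0 // subr_le0 (le_trans (maxm z isT)).
have /eqP : \sum_z - (q x z * (g z - g x)) = 0.
  by rewrite sumrN; apply/eqP; rewrite oppr_eq0; apply/eqP/hg.
rewrite psumr_eq0 => [/allP/(_ y (mem_index_enum _))/=|z _]; last first.
  by rewrite oppr_ge0.
by rewrite oppr_eq0 mulf_eq0 gt_eqF //= subr_eq0 => /eqP->.
Qed.

Lemma harmonic_constant g :
  (forall x, generator q g x = 0) -> forall x, g x = g x0.
Proof.
move=> hg x; apply/eqP; rewrite eq_le harmonic_le_root //=.
rewrite -lerN2; apply: (harmonic_le_root (g := fun x => - g x)) => {}x.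
rewrite -[RHS]oppr0 -[in RHS](hg x) /generator -sumrN; apply: eq_bigr => y _.
by rewrite -mulrN; congr (_ * _); rewrite opprB opprK addrC.
Qed.

(** A Fredholm alternative: since harmonic functions are constant, the range of the generator has
    codimension one, and by invariance of [pi] it consists of the functions of mean zero under
    [pi]. *)
Lemma poisson_equation (pi f : T -> R) :
  \sum_x pi x = 1 -> (forall g, \sum_x pi x * generator q g x = 0) ->
  exists g, forall x, generator q g x = \sum_y pi y * f y - f x.
Proof.
move=> pi1 piQ.
pose V := {ffun T -> R^o}.
(* Adding the rank-one term makes the generator injective, hence bijective. *)
pose L (g : V) : V := [ffun x => generator q g x + \sum_y pi y * g y].
have linL : linear L.
  move=> a u v; apply/ffunP=> x; rewrite !ffunE /generator.
  have scE (y : T) : (a *: u + v) y = a * u y + v y by rewrite !ffunE.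
  have -> (b : R^o) : a *: b = a * b by [].
  rewrite mulrDr addrACA !mulr_sumr -!big_split /=.
  by apply: eq_bigr => y _; rewrite !scE; lra.
pose LM := GRing.isLinear.Build R V V *:%R L linL.
pose Ll : {linear V -> V} := HB.pack L LM.
pose F : 'End(V) := linfun Ll.
have FE (g : V) x : F g x = generator q g x + \sum_y pi y * g y.
  by rewrite lfunE /= ffunE.
have piF (g : V) : \sum_x pi x * F g x = \sum_y pi y * g y.
  under eq_bigr do rewrite FE mulrDr.
  by rewrite big_split /= piQ add0r -mulr_suml pi1 mul1r.
have kerF : lker F == 0%VS.
  apply/lker0P => g h Fgh; apply/eqP; rewrite -subr_eq0; apply/eqP.
  have: F (g - h) = 0 by rewrite linearB /= Fgh subrr.
  move: (g - h) => k Fk.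
  (* A kernel element has mean zero by [piF], so it is harmonic, hence constant, hence zero. *)
  have pik : \sum_y pi y * k y = 0.
    by rewrite -piF big1 // => x _; rewrite Fk ffunE mulr0.
  have kc x : k x = k x0.
    by apply: harmonic_constant => y; move: (FE k y); rewrite Fk pik ffunE addr0.
  apply/ffunP=> x; rewrite ffunE -[RHS]pik.
  under eq_bigr do rewrite kc.
  by rewrite -mulr_suml pi1 mul1r kc.
pose w : V := [ffun x => \sum_y pi y * f y - f x].
have [g Fg] : exists g : V, F g = w.
  by exists ((F^-1)%VF w); apply: lker0_lfunVK.
(* The solution inherits mean zero from [w], so the rank-one term drops out. *)
have pig : \sum_y pi y * g y = 0.
  rewrite -piF Fg; under eq_bigr do rewrite ffunE mulrBr.
  by rewrite sumrB -mulr_suml pi1 mul1r subrr.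
by exists g => x; have := FE g x; rewrite Fg pig addr0 ffunE.
Qed.

End Poisson.

Lemma stationary_generator q (S : pred T) (pi : T -> R) :
  (forall x y, S x -> ~~ S y -> q x y = 0) -> stationary q S pi ->
  forall g, \sum_x pi x * generator q g x = 0.
Proof.
move=> closed [_ supp _ bal] g.
(* Balance is given on [S] only. Off [S] both sides vanish: [pi] is zero there and no rate leads out
   of [S]. *)
have full y : \sum_x pi x * q x y = pi y * \sum_x q y x.
  have [/bal//|nSy] := boolP (S y); rewrite supp // mul0r big1 // => x _.
  by have [Sx|/supp->] := boolP (S x); [rewrite closed ?mulr0|rewrite mul0r].
have -> : \sum_x pi x * generator q g x
    = \sum_x (\sum_y pi x * q x y * g y - pi x * (\sum_y q x y) * g x).
  apply: eq_bigr => x _; rewrite /generator.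
  under eq_bigr do rewrite mulrBr.
  rewrite sumrB mulrBr mulr_sumr -mulr_suml mulrA; congr (_ - _).
  by apply: eq_bigr => y _; rewrite mulrA.
rewrite sumrB exchange_big /= -sumrB big1 // => y _.
by rewrite -mulr_suml full subrr.
Qed.

End FiniteMarkov.

(** * Adding and removing one customer in a layer *)

Section Layer.
Context {K N : nat}.
Local Notation layer := {ffun 'I_K -> 'I_N.+1}.
Implicit Types (u v : layer) (k : 'I_K).

Definition layer_size v : nat := (\sum_k v k)%N.
(** [inord] sends out-of-range values to 0, so [incr] has its intended meaning only when [v k < N];
    [decr] truncates and leaves a zero entry unchanged. *)
Definition incr k v : layer := [ffun l => inord (v l + (l == k))].
Definition decr k v : layer := [ffun l => inord (v l - (l == k))].

Lemma incrE k v l : (v k < N)%N -> incr k v l = (v l + (l == k))%N :> nat.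
Proof.
move=> vk; rewrite ffunE inordK //; have [->|_] := eqVneq l k; first by lia.
by rewrite addn0.
Qed.

Lemma decrE k v l : decr k v l = (v l - (l == k))%N :> nat.
Proof. by rewrite ffunE inordK // ltnS (leq_trans (leq_subr _ _)) // -ltnS. Qed.

Lemma layer_size_D1 k v : layer_size v = (v k + \sum_(l | l != k) v l)%N.
Proof. by rewrite /layer_size (bigD1 k). Qed.

Lemma leq_layer_size k v : (v k <= layer_size v)%N.
Proof. by rewrite (layer_size_D1 k) leq_addr. Qed.

Lemma layer_size_incr k v : (v k < N)%N -> layer_size (incr k v) = (layer_size v).+1.
Proof.
move=> vk; rewrite !(layer_size_D1 k) incrE // eqxx addn1; congr (_ + _).+1.
by apply: eq_bigr => l /negPf lk; rewrite incrE // lk addn0.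
Qed.

Lemma layer_size_decr k v : (0 < v k)%N -> (layer_size (decr k v)).+1 = layer_size v.
Proof.
move=> vk; rewrite !(layer_size_D1 k) decrE eqxx -addSn subn1 prednK //.
by congr (_ + _)%N; apply: eq_bigr => l /negPf lk; rewrite decrE lk subn0.
Qed.

Lemma eq_incr k u v : (v k < N)%N ->
  [forall l, u l == (v l + (l == k))%N :> nat] = (u == incr k v).
Proof.
move=> vk; apply/forallP/eqP => [uv|-> l]; last by rewrite incrE.
by apply/ffunP => l; apply/val_inj; rewrite /= incrE //; apply/eqP/uv.
Qed.

Lemma eq_decr k u v : (0 < v k)%N ->
  [forall l, v l == (u l + (l == k))%N :> nat] = (u == decr k v).
Proof.
move=> vk; apply/forallP/eqP => [uv|-> l].
  by apply/ffunP => l; apply/val_inj; rewrite /= decrE (eqP (uv l)) addnK.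
by rewrite decrE; have [->|] := eqVneq l k; rewrite ?subn0 ?addn0 // subn1 addn1 prednK.
Qed.

Lemma incr0F k u v : v k = 0%N :> nat ->
  [forall l, v l == (u l + (l == k))%N :> nat] = false.
Proof. by move=> vk; apply/forallP => /(_ k); rewrite vk eqxx addn1. Qed.

End Layer.

(** * Two-layer systems with general departure rates *)

Record departure_rates {R : realFieldType} {K N} (d1 d2 : state K N -> 'I_K -> R) :
    Prop := DepartureRates {
  dep1_0 : forall (x : state K N) k, x.1 k = 0%N :> nat -> d1 x k = 0;
  dep2_0 : forall (x : state K N) k, x.2 k = 0%N :> nat -> d2 x k = 0;
  dep1_ge0 : forall (x : state K N) k, 0 <= d1 x k;
  dep2_ge0 : forall (x : state K N) k, 0 <= d2 x k;
  dep1_gt0 : forall (x : state K N) k, (0 < x.1 k)%N -> x.2 k = 0%N :> nat -> 0 < d1 x k;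
  dep2_gt0 : forall (x : state K N) k, (0 < x.2 k)%N -> 0 < d2 x k
}.

Section Generator.
Context {R : realFieldType} {K N : nat}.
Local Notation st := (state K N).
Variables (m : 'I_K -> nat) (n : nat) (lam : 'I_K -> R) (d1 d2 : st -> 'I_K -> R).
Implicit Types (x y : st) (k l : 'I_K) (g : st -> R).

Definition arrive k x : st :=
  if (x.1 k < m k)%N then (incr k x.1, x.2)
  else if (x.1 k == m k :> nat) && (layer_size x.2 < n)%N then (x.1, incr k x.2) else x.

(** Common form of the loss and maximum packing systems, which share their arrivals and differ only
    in [d1] and [d2]. *)
Definition two_layer_rate x y : R :=
  arr_rate m n lam x y
  + \sum_k (b2R (up1 k y x) * d1 x k + b2R (up2 k y x) * d2 x k).

Lemma st_sizeE x : st_size x = (layer_size x.1 + layer_size x.2)%N.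
Proof. by rewrite /st_size big_split. Qed.

Lemma eq_forallb2 (T : finType) (a b : pred T) :
  [forall l, a l && b l] = [forall l, a l] && [forall l, b l].
Proof.
apply/forallP/andP => [ab|[/forallP fa /forallP fb] l]; last by rewrite fa fb.
by split; apply/forallP => l; have /andP[] := ab l.
Qed.

Lemma eq_layer (u v : {ffun 'I_K -> 'I_N.+1}) :
  [forall l, u l == v l :> nat] = (u == v).
Proof.
by apply/forallP/eqP => [uv|->//]; apply/ffunP => l; apply/val_inj/eqP/uv.
Qed.

Lemma up1_incr k x y : (x.1 k < N)%N -> up1 k x y = (y == (incr k x.1, x.2)).
Proof.
by move=> xk; rewrite /up1 eq_forallb2 (eq_incr _ xk) eq_layer -pair_eqE.
Qed.

Lemma up2_incr k x y : (x.2 k < N)%N -> up2 k x y = (y == (x.1, incr k x.2)).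
Proof.
by move=> xk; rewrite /up2 eq_forallb2 (eq_incr _ xk) eq_layer -pair_eqE.
Qed.

Lemma up1_decr k x y : (0 < x.1 k)%N -> up1 k y x = (y == (decr k x.1, x.2)).
Proof.
move=> xk; rewrite /up1 eq_forallb2 (eq_decr _ xk) eq_layer -pair_eqE /=.
by rewrite [x.2 == _]eq_sym.
Qed.

Lemma up2_decr k x y : (0 < x.2 k)%N -> up2 k y x = (y == (x.1, decr k x.2)).
Proof.
move=> xk; rewrite /up2 eq_forallb2 (eq_decr _ xk) eq_layer -pair_eqE /=.
by rewrite [x.1 == _]eq_sym.
Qed.

Lemma up1_0 k x y : x.1 k = 0%N :> nat -> up1 k y x = false.
Proof. by move=> xk; rewrite /up1 eq_forallb2 (incr0F _ xk). Qed.

Lemma up2_0 k x y : x.2 k = 0%N :> nat -> up2 k y x = false.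
Proof. by move=> xk; rewrite /up2 eq_forallb2 (incr0F _ xk) andbF. Qed.

Lemma sum_b2R_eq (T : finType) (a : T) (F : T -> R) :
  \sum_y b2R (y == a) * F y = F a.
Proof.
rewrite (bigD1 a) //= eqxx mul1r big1 ?addr0 // => y /negPf->.
by rewrite mul0r.
Qed.

Hypotheses (mN : forall k, (m k <= N)%N) (nN : (n <= N)%N).

(** The condition [F x = 0] absorbs the blocked case, where there is no transition and [arrive k x]
    is [x] itself. *)
Lemma sum_arrivals k x (F : st -> R) : F x = 0 ->
  \sum_y (b2R (up1 k x y && (x1 x k < m k)%N)
     + b2R ([&& up2 k x y, x1 x k == m k & (\sum_l x2 x l < n)%N])) * F y
  = F (arrive k x).
Proof.
move=> Fx; rewrite /arrive /x1 -/(layer_size x.2).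
have [lt|ge] := ltnP (x.1 k) (m k).
  rewrite -[RHS]sum_b2R_eq; apply: eq_bigr => y _.
  by rewrite (ltn_eqF lt) andbF addr0 andbT up1_incr // (leq_trans lt).
have [/andP[_ lt]|no] := boolP ((x.1 k == m k :> nat) && (layer_size x.2 < n)%N).
  rewrite -[RHS]sum_b2R_eq; apply: eq_bigr => y _.
  rewrite andbF add0r andbT up2_incr //.
  exact: leq_ltn_trans (leq_layer_size k _) (leq_trans lt nN).
rewrite big1 // => y _; rewrite andbF add0r.
by rewrite andbF mul0r.
Qed.

Hypothesis dep : departure_rates d1 d2.

Lemma sum_two_layer_rate x (F : st -> R) : F x = 0 ->
  \sum_y two_layer_rate x y * F y =
  \sum_k (lam k * F (arrive k x)
          + (d1 x k * F (decr k x.1, x.2) + d2 x k * F (x.1, decr k x.2))).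
Proof.
move=> Fx; under eq_bigr do rewrite mulrDl !mulr_suml -big_split /=.
rewrite exchange_big; apply: eq_bigr => k _ /=.
rewrite big_split /=; congr (_ + _).
  rewrite -(sum_arrivals k Fx) mulr_sumr.
  by apply: eq_bigr => y _; rewrite mulrA.
under eq_bigr do rewrite mulrDl.
rewrite big_split /=; congr (_ + _).
  have [xk|xk] := posnP (x.1 k).
    by rewrite (dep1_0 dep) // mul0r big1 // => y _; rewrite up1_0 ?mul0r.
  rewrite -[in RHS](sum_b2R_eq _ F) mulr_sumr; apply: eq_bigr => y _.
  by rewrite up1_decr // -mulrA mulrCA.
have [xk|xk] := posnP (x.2 k).
  by rewrite (dep2_0 dep) // mul0r big1 // => y _; rewrite up2_0 ?mul0r.
rewrite -[in RHS](sum_b2R_eq _ F) mulr_sumr; apply: eq_bigr => y _.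
by rewrite up2_decr // -mulrA mulrCA.
Qed.

Lemma generatorE g x :
  generator two_layer_rate g x =
  \sum_k (lam k * (g (arrive k x) - g x)
          + (d1 x k * (g (decr k x.1, x.2) - g x)
             + d2 x k * (g (x.1, decr k x.2) - g x))).
Proof. exact: (sum_two_layer_rate (F := fun y => g y - g x)) (subrr _). Qed.

Lemma inSP x :
  reflect ((forall k, x.1 k <= m k)%N /\ (layer_size x.2 <= n)%N) (inS m n x).
Proof.
by apply: (iffP andP) => -[H ->]; split=> //; [move/forallP: H|apply/forallP].
Qed.

Lemma arrive_inS k x : inS m n x -> inS m n (arrive k x).
Proof.
move=> /[dup] Sx /inSP[x1m x2n]; rewrite /arrive.
case: ifP => [lt|_].
  apply/inSP; split=> //= l; rewrite incrE ?(leq_trans lt) //.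
  by have [->|_] := eqVneq l k; rewrite ?addn1 ?addn0.
case: ifP => [/andP[_ lt]|//].
apply/inSP; split=> //=; rewrite layer_size_incr //.
exact: leq_ltn_trans (leq_layer_size k _) (leq_trans lt nN).
Qed.

Lemma decr1_inS k x : inS m n x -> inS m n (decr k x.1, x.2).
Proof.
move=> /inSP[x1m x2n]; apply/inSP; split=> //= l.
by rewrite decrE (leq_trans (leq_subr _ _)).
Qed.

Lemma leq_layer_size_decr k (v : {ffun 'I_K -> 'I_N.+1}) : (layer_size (decr k v) <= layer_size v)%N.
Proof. by apply: leq_sum => l _; rewrite decrE leq_subr. Qed.

Lemma decr2_inS k x : inS m n x -> inS m n (x.1, decr k x.2).
Proof.
move=> /inSP[x1m x2n]; apply/inSP; split=> //=.
exact: leq_trans (leq_layer_size_decr _ _) _.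
Qed.

Lemma two_layer_closed x y : inS m n x -> ~~ inS m n y -> two_layer_rate x y = 0.
Proof.
(* Testing the sum formula on the indicator of [y] isolates the single rate; every move from [x]
   stays in [S], where this indicator vanishes. *)
move=> Sx nSy; pose F (z : st) : R := b2R (z == y).
have FS z : inS m n z -> F z = 0.
  by move=> Sz; rewrite /F; case: eqP => // zy; rewrite -zy Sz in nSy.
have := sum_two_layer_rate (FS x Sx).
under eq_bigr do rewrite mulrC.
rewrite sum_b2R_eq => ->; apply: big1 => k _.
by rewrite !FS ?arrive_inS ?decr1_inS ?decr2_inS // !mulr0 !addr0.
Qed.

Lemma sum_pi_generator pi : stationary two_layer_rate (inS m n) pi ->
  forall g, \sum_x pi x * generator two_layer_rate g x = 0.
Proof. exact: stationary_generator two_layer_closed. Qed.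

Hypothesis lam_ge0 : forall k, 0 <= lam k.

Lemma b2R_ge0 b : 0 <= b2R b :> R.
Proof. by case: b. Qed.

Lemma arr_rate_ge0 x y : 0 <= arr_rate m n lam x y.
Proof. by apply: sumr_ge0 => k _; rewrite mulr_ge0 // addr_ge0 // b2R_ge0. Qed.

Lemma dep_rate_ge0 x y k : 0 <= b2R (up1 k y x) * d1 x k + b2R (up2 k y x) * d2 x k.
Proof. by rewrite addr_ge0 // mulr_ge0 ?b2R_ge0 ?(dep1_ge0 dep) ?(dep2_ge0 dep). Qed.

Lemma two_layer_rate_ge0 x y : 0 <= two_layer_rate x y.
Proof. by rewrite addr_ge0 ?arr_rate_ge0 // sumr_ge0 // => k _; apply: dep_rate_ge0. Qed.

Definition empty_state : st := ([ffun=> ord0], [ffun=> ord0]).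

(** Layer 2 is emptied first: a layer-1 departure is only known to have positive rate when layer 2
    holds no customer of its class, as under maximum packing. *)
Lemma two_layer_rate_down x : x != empty_state ->
  exists2 y, 0 < two_layer_rate x y & (st_size y < st_size x)%N.
Proof.
move=> x0.
have dep_gt0 k y : 0 < b2R (up1 k y x) * d1 x k + b2R (up2 k y x) * d2 x k ->
    0 < two_layer_rate x y.
  move=> yk; rewrite ltr_wpDl ?arr_rate_ge0 // (bigD1 k) //= ltr_pwDl //.
  by rewrite sumr_ge0 // => l _; apply: dep_rate_ge0.
have [/existsP[k xk]|/existsPn no2] := boolP [exists k, (0 < x.2 k)%N].
  exists (x.1, decr k x.2).
    apply: (dep_gt0 k); rewrite up2_decr // eqxx mul1r ltr_wpDl //.
      by rewrite mulr_ge0 ?b2R_ge0 ?(dep1_ge0 dep) ?(dep2_ge0 dep).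
    exact: (dep2_gt0 dep).
  by rewrite !st_sizeE /= -(layer_size_decr xk) addnS.
have x20 k : x.2 k = 0%N :> nat by have := no2 k; rewrite lt0n negbK => /eqP.
have [/existsP[k xk]|/existsPn no1] := boolP [exists k, (0 < x.1 k)%N].
  exists (decr k x.1, x.2).
    apply: (dep_gt0 k); rewrite up1_decr // eqxx mul1r ltr_pwDl //.
      exact: (dep1_gt0 dep).
    by rewrite mulr_ge0 ?b2R_ge0 ?(dep1_ge0 dep) ?(dep2_ge0 dep).
  by rewrite !st_sizeE /= -(layer_size_decr xk) addSn.
case/eqP: x0; case: x {dep_gt0} no1 no2 x20 => u v /= no1 _ x20.
congr (_, _); apply/ffunP => k; apply/val_inj; rewrite ffunE //=.
by have := no1 k; rewrite lt0n negbK => /eqP.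
Qed.

Lemma two_layer_poisson pi (f : st -> R) : stationary two_layer_rate (inS m n) pi ->
  exists g, forall x, generator two_layer_rate g x = \sum_y pi y * f y - f x.
Proof.
move=> stat; apply: (poisson_equation two_layer_rate_ge0 two_layer_rate_down).
  by case: stat.
exact: sum_pi_generator.
Qed.

End Generator.

(** * Stationary comparison of two systems along the relation [dominated] *)

Section Comparison.
Context {R : realFieldType} {K NA NB : nat}.
Variables (m mA c : 'I_K -> nat) (nA nB : nat) (lam : 'I_K -> R).
Variables (d1 d2 : state K NA -> 'I_K -> R) (e1 e2 : state K NB -> 'I_K -> R).
Implicit Types (x : state K NA) (z : state K NB) (k l : 'I_K).

Definition dominated x z : bool :=
  [forall k, (x.1 k <= z.1 k + c k)%N] && (st_size x <= st_size z)%N.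

Lemma dominatedP x z :
  reflect ((forall k, x.1 k <= z.1 k + c k)%N /\
           (layer_size x.1 + layer_size x.2 <= layer_size z.1 + layer_size z.2)%N) (dominated x z).
Proof.
by rewrite /dominated !st_sizeE;
  apply: (iffP andP) => -[H ->]; split=> //; [move/forallP: H|apply/forallP].
Qed.

Hypothesis mAE : forall k, mA k = (m k + c k)%N.
Hypotheses (mAN : forall k, (mA k <= NA)%N) (nAN : (nA <= NA)%N).
Hypotheses (mBN : forall k, (m k <= NB)%N) (nBN : (nB <= NB)%N).
Hypothesis nBE : nB = (nA + \sum_k c k)%N.

Lemma ltn_layer_size_slack k x z : (forall l, x.1 l <= z.1 l + c l)%N ->
  (x.1 k < z.1 k + c k)%N -> (layer_size x.1 < layer_size z.1 + \sum_l c l)%N.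
Proof.
move=> xz lt; rewrite /layer_size -big_split /= [ltnRHS](bigD1 k) // [ltnLHS](bigD1 k) //=.
by rewrite -addSn leq_add // leq_sum.
Qed.

Lemma leq_layer_size_slack x z : (forall l, x.1 l <= z.1 l + c l)%N ->
  (layer_size x.1 <= layer_size z.1 + \sum_l c l)%N.
Proof. by move=> xz; rewrite /layer_size -big_split leq_sum. Qed.

(** The critical case is an arrival accepted at [x] and blocked at [z]. Then
    [|z| = |z.1| + nA + sum_l c l], while [|x.1| <= |z.1| + sum_l c l] and [|x.2| <= nA]. One of
    these two is strict, since [x] had room in layer 1 for class [k] or in layer 2; so [|x| < |z|]
    held before the arrival. *)
Lemma arrive_dominated k x z : inS mA nA x -> inS m nB z -> dominated x z ->
  dominated (arrive mA nA k x) (arrive m nB k z).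
Proof.
move=> /inSP[x1m x2n] /inSP[z1m z2n] /dominatedP[xz le].
have tot := leq_layer_size_slack xz.
have ltA (u : {ffun 'I_K -> 'I_NA.+1}) : (layer_size u < nA)%N -> (u k < NA)%N.
  by move=> lt; apply: leq_ltn_trans (leq_layer_size k u) (leq_trans lt nAN).
have ltB (u : {ffun 'I_K -> 'I_NB.+1}) : (layer_size u < nB)%N -> (u k < NB)%N.
  by move=> lt; apply: leq_ltn_trans (leq_layer_size k u) (leq_trans lt nBN).
have ltA1 : (x.1 k < mA k -> x.1 k < NA)%N by move=> lt; apply: leq_trans lt _.
have ltB1 : (z.1 k < m k -> z.1 k < NB)%N by move=> lt; apply: leq_trans lt _.
have tot' : (x.1 k < mA k -> z.1 k = m k :> nat ->
             layer_size x.1 < layer_size z.1 + \sum_l c l)%N.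
  by move=> lt zk; apply: (ltn_layer_size_slack (k := k)) => //; rewrite zk -mAE.
have := xz k; have := x1m k; have := z1m k; have := mAE k; rewrite /arrive.
case: (ltnP (x.1 k) (mA k)) => [xk|xk]; last case: ifP => [/andP[/eqP xk' xn]|xno];
  (case: (ltnP (z.1 k) (m k)) => [zk|zk]; last case: ifP => [/andP[/eqP zk' zn]|zno]);
  move=> ? ? ? ?; apply/dominatedP; split=> /= [l|];
  rewrite ?layer_size_incr ?incrE; auto; try (have := xz l);
  try (have [->|_] := eqVneq l k); try lia.
Qed.

Lemma decr1_dominated l x z : dominated x z -> dominated (decr l x.1, x.2) z.
Proof.
move=> /dominatedP[xz le]; apply/dominatedP; split=> [k|] /=.
  by rewrite decrE (leq_trans (leq_subr _ _)).
by have := leq_layer_size_decr l x.1; lia.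
Qed.

Lemma decr2_dominated l x z : dominated x z -> dominated (x.1, decr l x.2) z.
Proof.
move=> /dominatedP[xz le]; apply/dominatedP; split=> //=.
by have := leq_layer_size_decr l x.2; lia.
Qed.

Lemma dominated_decr1 l x z : dominated x z -> (st_size x < st_size z)%N ->
  (x.1 l < z.1 l + c l)%N -> (0 < z.1 l)%N -> dominated x (decr l z.1, z.2).
Proof.
rewrite !st_sizeE => /dominatedP[xz le] lt xzl zl.
apply/dominatedP; split=> [k|] /=; last by have := layer_size_decr zl; lia.
by rewrite decrE; have := xz k; have [->|_] := eqVneq k l; lia.
Qed.

Lemma dominated_decr2 l x z : dominated x z -> (st_size x < st_size z)%N ->
  (0 < z.2 l)%N -> dominated x (z.1, decr l z.2).
Proof.
rewrite !st_sizeE => /dominatedP[xz le] lt zl.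
by apply/dominatedP; split=> //=; have := layer_size_decr zl; lia.
Qed.

Lemma st_size_decr1 N (y : state K N) l : (0 < y.1 l)%N ->
  (st_size (decr l y.1, y.2) : nat).+1 = st_size y.
Proof. by move=> yl; rewrite !st_sizeE /= -addSn layer_size_decr. Qed.

Lemma st_size_decr2 N (y : state K N) l : (0 < y.2 l)%N ->
  (st_size (y.1, decr l y.2) : nat).+1 = st_size y.
Proof. by move=> yl; rewrite !st_sizeE /= -addnS layer_size_decr. Qed.

Lemma decr11_dominated l x z : dominated x z -> (0 < x.1 l)%N -> (0 < z.1 l)%N ->
  dominated (decr l x.1, x.2) (decr l z.1, z.2).
Proof.
move=> /dominatedP[xz le] xl zl; apply/dominatedP; split=> [k|] /=; last first.
  by have := layer_size_decr xl; have := layer_size_decr zl; lia.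
by rewrite !decrE; have := xz k; have [->|_] := eqVneq k l; lia.
Qed.

Hypothesis lam_ge0 : forall k, 0 <= lam k.
Hypotheses (dep_d : departure_rates d1 d2) (dep_e : departure_rates e1 e2).
(** Service enters through two conditions. In a tight class a layer-1 departure from [z] must be
    matched by one from [x], or the relation breaks; at equal sizes [x] must lose customers at least
    as fast as [z]. *)
Hypothesis tight_rate : forall x z l, x.1 l = (z.1 l + c l)%N :> nat -> e1 z l <= d1 x l.
Hypothesis total_rate : forall x z, st_size x = st_size z ->
  \sum_k (e1 z k + e2 z k) <= \sum_k (d1 x k + d2 x k).

(* Here [a], [b] are the increments of [g], [h] at departures; the threshold [M]
   replaces the coupling of the departures that are not tight. *)
Lemma departures_le (M : R) (a1 a2 b1 b2 p1 p2 q1 q2 : 'I_K -> R) (tight : pred 'I_K) :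
  (forall l, 0 <= p1 l) -> (forall l, 0 <= q1 l) ->
  (forall l, p1 l * a1 l <= p1 l * M) -> (forall l, p2 l * a2 l <= p2 l * M) ->
  (forall l, q2 l * M <= q2 l * b2 l) ->
  (forall l, ~~ tight l -> q1 l * M <= q1 l * b1 l) ->
  (forall l, tight l -> q1 l <= p1 l /\ q1 l * a1 l <= q1 l * b1 l) ->
  M * \sum_k (p1 k + p2 k) <= M * \sum_k (q1 k + q2 k) ->
  \sum_k (p1 k * a1 k + p2 k * a2 k) <= \sum_k (q1 k * b1 k + q2 k * b2 k).
Proof.
move=> p0 q0 pa pa2 qb qbN qbT; rewrite -subr_le0 => pqM.
rewrite -subr_le0 (le_trans _ pqM) // -mulrBr -!sumrB mulr_sumr; apply: ler_sum => l _.
have := pa2 l; have := qb l; have := pa l; have [tl|tl] := boolP (tight l).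
  have [le le1] := qbT l tl; have := p0 l; have := q0 l => ql pl h1 h2 h3.
  (* In a tight class [p1 l] splits into a part [q1 l], matched with the departure of the other
     system, and a surplus charged at [M]. If [p1 l = 0], nothing bounds [a1 l], but the surplus is
     zero too. *)
  have : 0 <= (p1 l - q1 l) * (M - a1 l).
    have [pl0|pl0] := eqVneq (p1 l) 0.
      have -> : q1 l = 0 by lra.
      by rewrite pl0 subrr mul0r.
    by rewrite mulr_ge0 ?subr_ge0 // -(ler_pM2l (x := p1 l)) // lt_def pl0.
  by lra.
by have := qbN l tl; lra.
Qed.

(** Maximality turns every move, joint or one-sided, that keeps the relation into an inequality
    between increments of [g] and [h]. Arrivals are matched class by class, departures through
    [departures_le]. *)
Lemma generator_le_at_max g h x z :
  inS mA nA x -> inS m nB z -> dominated x z ->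
  (forall x' z', inS mA nA x' -> inS m nB z' -> dominated x' z' ->
     g x' - h z' <= g x - h z) ->
  generator (two_layer_rate mA nA lam d1 d2) g x
  <= generator (two_layer_rate m nB lam e1 e2) h z.
Proof.
move=> Sx Sz xz maxgh.
have [d1_0 d2_0 d1_ge0 d2_ge0 _ _] := dep_d.
have [e1_0 e2_0 e1_ge0 e2_ge0 _ _] := dep_e.
rewrite !generatorE // !big_split /= -!big_split /= [leLHS]big_split [leRHS]big_split /=.
apply: lerD.
  apply: ler_sum => k _; apply: ler_wpM2l => //.
  have := maxgh (arrive mA nA k x) (arrive m nB k z).
  by rewrite !arrive_inS // arrive_dominated // => /(_ isT isT isT); lra.
have a1_le0 l : g (decr l x.1, x.2) - g x <= 0.
  have := maxgh _ _ (decr1_inS l Sx) Sz (decr1_dominated l xz); lra.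
have a2_le0 l : g (x.1, decr l x.2) - g x <= 0.
  have := maxgh _ _ (decr2_inS l Sx) Sz (decr2_dominated l xz); lra.
have b1_tight l : x.1 l = (z.1 l + c l)%N :> nat -> (0 < z.1 l)%N ->
    g (decr l x.1, x.2) - g x <= h (decr l z.1, z.2) - h z.
  move=> xzl zl; have xl : (0 < x.1 l)%N by lia.
  have := maxgh _ _ (decr1_inS l Sx) (decr1_inS l Sz) (decr11_dominated xz xl zl).
  lra.
(* With room between [|x|] and [|z|], [M = 0] works; otherwise [M] is the
   largest increment of [g] over the possible departures from [x]. *)
have [M [M_le0 M1 M2 [N1 N2] eqM]] : exists M, [/\ M <= 0,
    forall l, (0 < x.1 l)%N -> g (decr l x.1, x.2) - g x <= M,
    forall l, (0 < x.2 l)%N -> g (x.1, decr l x.2) - g x <= M,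
    (forall l, (x.1 l < z.1 l + c l)%N -> (0 < z.1 l)%N ->
      M <= h (decr l z.1, z.2) - h z) /\
    (forall l, (0 < z.2 l)%N -> M <= h (z.1, decr l z.2) - h z)
  & st_size x = st_size z \/ M = 0].
  have [lt|ge] := ltnP (st_size x) (st_size z).
    exists 0; split=> //; last by right.
    split=> l.
      move=> xzl zl.
      have := maxgh _ _ Sx (decr1_inS l Sz) (dominated_decr1 xz lt xzl zl); lra.
    move=> zl; have := maxgh _ _ Sx (decr2_inS l Sz) (dominated_decr2 xz lt zl); lra.
  have eqs : st_size x = st_size z.
    by apply/eqP; rewrite eqn_leq ge andbT; case/andP: xz.
  pose D (i : bool * 'I_K) : state K NA :=
    if i.1 then (decr i.2 x.1, x.2) else (x.1, decr i.2 x.2).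
  pose act (i : bool * 'I_K) := (0 < if i.1 then x.1 i.2 else x.2 i.2)%N.
  (* If no departure from [x] is possible, both states are empty and [M = 0] serves. *)
  have [i0 act0|noact] := pickP act; last first.
    have size0 : st_size x = 0%N.
      rewrite /st_size big1 // => l _.
      by have := noact (true, l); have := noact (false, l); rewrite /act /x1 /x2 /=; lia.
    exists 0; split=> //; last by left.
    have : layer_size z.1 = 0%N /\ layer_size z.2 = 0%N.
      by move: eqs; rewrite size0 st_sizeE; lia.
    case=> z10 z20; split=> l.
      by move=> _; have := leq_layer_size l z.1; lia.
    by have := leq_layer_size l z.2; lia.
  have [i acti maxi] := arg_maxP (fun j => g (D j) - g x) act0.
  (* Moving [x] to [D i] first makes the sizes strictly ordered, so a departure from [z], in layer 2
     or in a class that is not tight, keeps the relation with [D i]. Maximality then bounds its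
     increment below by [M]. *)
  have SD : inS mA nA (D i) by rewrite /D; case: ifP => _; [apply: decr1_inS|apply: decr2_inS].
  have xD : dominated (D i) z.
    by rewrite /D; case: ifP => _; [apply: decr1_dominated|apply: decr2_dominated].
  have ltD : (st_size (D i) < st_size z)%N.
    rewrite -eqs; move: acti; rewrite /D /act; case: ifP => _ acti.
      by rewrite -(st_size_decr1 acti).
    by rewrite -(st_size_decr2 acti).
  have D1 l : ((D i).1 l <= x.1 l)%N.
    by rewrite /D; case: ifP => _ //=; rewrite decrE leq_subr.
  exists (g (D i) - g x); split; last by left.
  - by rewrite /D; case: ifP.
  - by move=> l xl; apply: (maxi (true, l)).
  - by move=> l xl; apply: (maxi (false, l)).
  split=> l.
    move=> xzl zl.
    have := maxgh _ _ SD (decr1_inS l Sz)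
      (dominated_decr1 xD ltD (leq_ltn_trans (D1 l) xzl) zl); lra.
  move=> zl; have := maxgh _ _ SD (decr2_inS l Sz) (dominated_decr2 xD ltD zl); lra.
apply: (departures_le (M := M) (tight := fun l => x.1 l == (z.1 l + c l)%N :> nat)) => //.
- move=> l; have [xl|xl] := posnP (x.1 l); first by rewrite d1_0 // !mul0r.
  by rewrite ler_wpM2l // M1.
- move=> l; have [xl|xl] := posnP (x.2 l); first by rewrite d2_0 // !mul0r.
  by rewrite ler_wpM2l // M2.
- move=> l; have [zl|zl] := posnP (z.2 l); first by rewrite e2_0 // !mul0r.
  by rewrite ler_wpM2l // N2.
- move=> l ntl; have [zl|zl] := posnP (z.1 l); first by rewrite e1_0 // !mul0r.
  by rewrite ler_wpM2l // N1 //; case/dominatedP: xz => /(_ l); lia.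
- move=> l /eqP tl; split; first exact: tight_rate.
  have [zl|zl] := posnP (z.1 l); first by rewrite e1_0 // !mul0r.
  by rewrite ler_wpM2l // b1_tight.
(* At equal sizes, [M <= 0] reverses the inequality of the total rates. *)
by case: eqM => [eqs|->]; [rewrite ler_wnM2l // total_rate|rewrite !mul0r].
Qed.

Lemma stationary_compare (piA fA : state K NA -> R) (piB fB : state K NB -> R) :
  stationary (two_layer_rate mA nA lam d1 d2) (inS mA nA) piA ->
  stationary (two_layer_rate m nB lam e1 e2) (inS m nB) piB ->
  (forall x z, dominated x z -> fA x <= fB z) ->
  \sum_x piA x * fA x <= \sum_z piB z * fB z.
Proof.
move=> statA statB fAB.
have [g Lg] := two_layer_poisson mAN nAN dep_d lam_ge0 fA statA.
have [h Lh] := two_layer_poisson mBN nBN dep_e lam_ge0 fB statB.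
pose rel (p : state K NA * state K NB) :=
  [&& inS mA nA p.1, inS m nB p.2 & dominated p.1 p.2].
(* The empty states are related, so the maximum is over a nonempty set. *)
have rel0 : rel (empty_state, empty_state).
  have ls0 N : layer_size ([ffun=> ord0] : {ffun 'I_K -> 'I_N.+1}) = 0%N.
    by apply: big1 => k _; rewrite ffunE.
  apply/and3P; split; [apply/inSP|apply/inSP|apply/dominatedP];
    by split=> /= [k|]; rewrite ?ls0 ?ffunE.
have [[x z] /and3P[Sx Sz xz] maxgh] := arg_maxP (fun p => g p.1 - h p.2) rel0.
have := generator_le_at_max Sx Sz xz.
move=> /(_ g h) H; have {}H : generator (two_layer_rate mA nA lam d1 d2) g x
    <= generator (two_layer_rate m nB lam e1 e2) h z.
  apply: H => x' z' Sx' Sz' xz'.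
  by apply: (maxgh (x', z')); rewrite /rel Sx' Sz'.
by move: H; rewrite Lg Lh; have := fAB _ _ xz; lra.
Qed.

End Comparison.

(** * Loss and maximum packing rates; flow balance *)

Section Rates.
Context {R : realFieldType} {K N : nat}.
Local Notation st := (state K N).
Variables (m : 'I_K -> nat) (n : nat) (lam mu : 'I_K -> R).
Implicit Types (x y : st) (k : 'I_K) (pi f : st -> R).

Definition loss_dep1 x k : R := mu k * (x.1 k)%:R.
Definition loss_dep2 x k : R := mu k * (x.2 k)%:R.
Definition mp_dep1 x k : R := mu k * ((x.2 k == 0%N :> nat) * x.1 k)%N%:R.
Definition mp_dep2 x k : R := mu k * (x.1 k * (0 < x.2 k) + x.2 k)%N%:R.

Lemma loss_rateE x y :
  loss_rate m n lam mu x y = two_layer_rate m n lam loss_dep1 loss_dep2 x y.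
Proof.
rewrite /loss_rate /two_layer_rate; congr (_ + _); apply: eq_bigr => k _.
by rewrite mulrDr !(mulrCA (mu k)).
Qed.

Lemma mp_rateE x y :
  mp_rate m n lam mu x y = two_layer_rate m n lam mp_dep1 mp_dep2 x y.
Proof.
rewrite /mp_rate /two_layer_rate; congr (_ + _); apply: eq_bigr => k _.
rewrite mulrDr !(mulrCA (mu k)) /mp_dep1 /mp_dep2 /x1 /x2 natrD; congr (_ + _).
case: (up1 k y x) => /=; rewrite ?mul0r //; case: eqP => _ /=.
  by rewrite mul1n.
by rewrite mul0n mul0r mulr0 mul1r.
Qed.

Lemma eq_stationary (T : finType) (q q' : T -> T -> R) (S : pred T) (pi : T -> R) :
  (forall x y : T, q x y = q' x y) -> stationary q S pi -> stationary q' S pi.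
Proof.
move=> qq' [pi0 supp pi1 bal]; split=> // x Sx.
under eq_bigr do rewrite -qq'.
by rewrite bal //; congr (_ * _); apply: eq_bigr.
Qed.

Lemma loss_stationary pi : stationary (loss_rate m n lam mu) (inS m n) pi ->
  stationary (two_layer_rate m n lam loss_dep1 loss_dep2) (inS m n) pi.
Proof. exact/eq_stationary/loss_rateE. Qed.

Lemma mp_stationary pi : stationary (mp_rate m n lam mu) (inS m n) pi ->
  stationary (two_layer_rate m n lam mp_dep1 mp_dep2) (inS m n) pi.
Proof. exact/eq_stationary/mp_rateE. Qed.

(** Maximum packing changes the layer from which a customer leaves, not the total departure rate of
    the class. *)
Lemma mp_depD x k : mp_dep1 x k + mp_dep2 x k = mu k * (x1 x k + x2 x k)%N%:R.
Proof. by rewrite -mulrDr -natrD /x1 /x2; congr (_ * _%:R); case: eqP; lia. Qed.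

Lemma loss_depD x k : loss_dep1 x k + loss_dep2 x k = mu k * (x1 x k + x2 x k)%N%:R.
Proof. by rewrite -mulrDr -natrD. Qed.

Section Positive.
Hypothesis mu_gt0 : forall k, 0 < mu k.

Lemma loss_departure_rates : departure_rates loss_dep1 loss_dep2.
Proof.
split=> x k; rewrite /loss_dep1 /loss_dep2.
- by move->; rewrite mulr0.
- by move->; rewrite mulr0.
- by rewrite mulr_ge0 // ltW.
- by rewrite mulr_ge0 // ltW.
- by move=> xk _; rewrite mulr_gt0 // ltr0n.
- by move=> xk; rewrite mulr_gt0 // ltr0n.
Qed.

Lemma mp_departure_rates : departure_rates mp_dep1 mp_dep2.
Proof.
split=> x k; rewrite /mp_dep1 /mp_dep2.
- by move->; rewrite muln0 mulr0.
- by move->; rewrite muln0 mulr0.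
- by rewrite mulr_ge0 // ltW.
- by rewrite mulr_ge0 // ltW.
- by move=> xk ->; rewrite mulr_gt0 // ltr0n mul1n.
- by move=> xk; rewrite mulr_gt0 // ltr0n addn_gt0 xk orbT.
Qed.

End Positive.

Lemma ameanE pi : amean pi = \sum_x pi x * st_sizeR x.
Proof.
rewrite /amean /amean_k exchange_big; apply: eq_bigr => x _.
by rewrite -mulr_sumr /st_sizeR /st_size natr_sum.
Qed.

Lemma sum_b2R (T : finType) (P : pred T) (F : T -> R) :
  \sum_(x | P x) F x = \sum_x F x * b2R (P x).
Proof.
by rewrite big_mkcond; apply: eq_bigr => x _; case: (P x); rewrite ?mulr1 ?mulr0.
Qed.

Section FlowBalance.
Variables (d1 d2 : st -> 'I_K -> R) (pi : st -> R).
Hypotheses (mN : forall k, (m k <= N)%N) (nN : (n <= N)%N).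
Hypothesis dep : departure_rates d1 d2.
Hypothesis depD : forall x k, d1 x k + d2 x k = mu k * (x1 x k + x2 x k)%N%:R.
Hypothesis stat : stationary (two_layer_rate m n lam d1 d2) (inS m n) pi.

(** Within [S], a class-[k] arrival is lost exactly on [B_k]; this is how blocking probabilities
    enter the flow balance. *)
Lemma st_size_arrive k x : inS m n x ->
  st_sizeR (arrive m n k x) - st_sizeR x = 1 - b2R (inB m n k x) :> R.
Proof.
move=> /inSP[x1m x2n]; rewrite /arrive /inB /st_sizeR !st_sizeE.
rewrite /x1 -[(\sum_l x2 x l)%N]/(layer_size x.2).
have le := x1m k; case: (ltnP (x.1 k) (m k)) => [lt|ge] /=.
  rewrite (ltn_eqF lt) /= layer_size_incr ?(leq_trans lt) //.
  by rewrite -natrB ?subr0 ?addSn ?leqnSn // subSnn.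
rewrite eqn_leq le ge /= [X in b2R X]eqn_leq x2n /=.
case: (ltnP (layer_size x.2) n) => [lt|_] /=; last by rewrite !subrr.
rewrite layer_size_incr; last first.
  exact: leq_ltn_trans (leq_layer_size k _) (leq_trans lt nN).
by rewrite -natrB ?subr0 ?addnS ?leqnSn // subSnn.
Qed.

Lemma departures_st_size k x :
  d1 x k * (st_sizeR (decr k x.1, x.2) - st_sizeR x)
  + d2 x k * (st_sizeR (x.1, decr k x.2) - st_sizeR x)
  = - (mu k * (x1 x k + x2 x k)%N%:R).
Proof.
rewrite -depD opprD; congr (_ + _).
  have [xk|xk] := posnP (x.1 k); first by rewrite (dep1_0 dep) // mul0r oppr0.
  rewrite /st_sizeR -(st_size_decr1 xk) -(addn1 (st_size _)) natrD.
  by rewrite opprD addNKr mulrN1.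
have [xk|xk] := posnP (x.2 k); first by rewrite (dep2_0 dep) // mul0r oppr0.
rewrite /st_sizeR -(st_size_decr2 xk) -(addn1 (st_size _)) natrD.
by rewrite opprD addNKr mulrN1.
Qed.

Lemma flow_balance : \sum_k lam k * (1 - blk_k m n pi k) = thr mu pi.
Proof.
have [_ supp pi1 _] := stat.
have := sum_pi_generator mN nN dep stat (fun x => st_sizeR x).
have -> : \sum_x pi x * generator (two_layer_rate m n lam d1 d2) (fun x => st_sizeR x) x
   = \sum_x \sum_k (lam k * (pi x - pi x * b2R (inB m n k x))
                    - mu k * (pi x * (x1 x k + x2 x k)%N%:R)).
  apply: eq_bigr => x _.
  have [Sx|/supp->] := boolP (inS m n x); last first.
    by rewrite mul0r big1 // => k _; rewrite !mul0r subrr !mulr0 subrr.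
  rewrite generatorE // mulr_sumr; apply: eq_bigr => k _.
  by rewrite st_size_arrive // departures_st_size; lra.
rewrite exchange_big /=.
under eq_bigr do rewrite sumrB -!mulr_sumr sumrB pi1 -sum_b2R.
by rewrite sumrB => /eqP; rewrite subr_eq0 => /eqP.
Qed.

(** Reconciles the two expressions for the overall blocking probability, so that throughput bounds
    become blocking bounds. *)
Lemma blkE : 0 < \sum_k lam k -> blk m n lam pi = 1 - thr mu pi / \sum_k lam k.
Proof.
move=> Lam; rewrite -flow_balance /blk.
under [in RHS]eq_bigr do rewrite mulrBr mulr1.
by rewrite sumrB mulrBl divff ?gt_eqF // opprB addrCA subrr addr0.
Qed.

End FlowBalance.

Lemma thr_le_amean (c : R) pi : (forall k, mu k <= c) -> (forall x, 0 <= pi x) ->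
  thr mu pi <= c * amean pi.
Proof.
move=> muc pi0; rewrite /thr /amean mulr_sumr; apply: ler_sum => k _.
by apply: ler_wpM2r => //; apply: sumr_ge0 => x _; rewrite mulr_ge0.
Qed.

Lemma amean_le_thr (c : R) pi : (forall k, c <= mu k) -> (forall x, 0 <= pi x) ->
  c * amean pi <= thr mu pi.
Proof.
move=> muc pi0; rewrite /thr /amean mulr_sumr; apply: ler_sum => k _.
by apply: ler_wpM2r => //; apply: sumr_ge0 => x _; rewrite mulr_ge0.
Qed.

End Rates.

Lemma thr_const {R : realFieldType} {K N} (c : R) (pi : state K N -> R) :
  thr (fun _ => c) pi = c * amean pi.
Proof. by rewrite /thr -mulr_sumr. Qed.

(** * Extreme service rates *)

Section Extremes.
Context {R : realFieldType} {K : nat} (mu : 'I_K -> R).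

Lemma mu_le_max k : mu k <= mu_max mu.
Proof. exact: le_bigmax. Qed.

Lemma mu_min_le k : mu_min mu <= mu k.
Proof. exact: bigmin_le. Qed.

Hypotheses (K_gt0 : (0 < K)%N) (mu_gt0 : forall k, 0 < mu k).

Lemma mu_max_gt0 : 0 < mu_max mu.
(* The maximum starts from 0, so its positivity comes from an actual class. *)
Proof. exact: lt_le_trans (mu_gt0 (Ordinal K_gt0)) (mu_le_max _). Qed.

Lemma mu_min_gt0 : 0 < mu_min mu.
Proof. by apply: lt_bigmin => //; apply: mu_max_gt0. Qed.

End Extremes.

(** * The two stochastic bounds and their consequences *)

Lemma dominated_order {R : realFieldType} {K NA NB} (c : 'I_K -> nat)
    (piA : state K NA -> R) (piB : state K NB -> R) :
  (forall fA fB, (forall x z, dominated c x z -> fA x <= fB z) ->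
     \sum_x piA x * fA x <= \sum_z piB z * fB z) ->
  stle piA st_sizeR piB st_sizeR /\ amean piA <= amean piB.
Proof.
move=> le; split=> [t|].
  (* The test functions are the indicators of [t < |x|], then [|x|] itself for the mean. *)
  rewrite [leLHS]sum_b2R [leRHS]sum_b2R; apply: le => x z /andP[_ xz].
  have [tx|_] := boolP (t < st_sizeR x); last exact: b2R_ge0.
  by rewrite (lt_le_trans tx) // ler_nat.
by rewrite !ameanE; apply: le => x z /andP[_ xz]; rewrite ler_nat.
Qed.

Lemma leq_Nb_layer1 K (m : 'I_K -> nat) n k : (m k <= Nb m n)%N.
Proof. by rewrite /Nb (bigD1 k) //= -addnA leq_addr. Qed.

Lemma leq_Nb_layer2 K (m : 'I_K -> nat) n : (n <= Nb m n)%N.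
Proof. exact: leq_addl. Qed.

Section Bounds.
Context {R : realFieldType} {K : nat} (m : 'I_K -> nat) (n : nat) (lam mu : 'I_K -> R).
Hypotheses (lam_gt0 : forall k, 0 < lam k) (mu_gt0 : forall k, 0 < mu k).
Variable pi : state K (Nb m n) -> R.
Hypothesis stat : stationary (loss_rate m n lam mu) (inS m n) pi.

Let lam_ge0 k : 0 <= lam k. Proof. exact: ltW. Qed.

(** Membership in [C_{m,n}] makes the slacks [m' k - m k] sum to [n]. In a tight class the dedicated
    system has at least as many layer-1 customers, each served at rate [c], at least [mu k]; at
    equal sizes its total rate [c |x|] also dominates. *)
Lemma dedicated_compare (c : R) (m' : 'I_K -> nat) (pi' : state K (Nb m' 0) -> R) :
  (forall k, mu k <= c) -> 0 < c -> inC m n m' ->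
  stationary (loss_rate m' 0 lam (fun=> c)) (inS m' 0) pi' ->
  stle pi' st_sizeR pi st_sizeR /\ amean pi' <= amean pi.
Proof.
move=> muc c_gt0 /andP[/forallP mm' /eqP m'E] stat'.
apply: (dominated_order (c := fun k => m' k - m k)%N) => fA fB.
apply: (stationary_compare _ _ _ _ _ _ lam_ge0
  (loss_departure_rates (fun=> c_gt0)) (loss_departure_rates mu_gt0) _ _
  (loss_stationary stat') (loss_stationary stat)).
- by move=> k; rewrite subnKC.
- by move=> k; apply: leq_Nb_layer1.
- exact: leq_Nb_layer2.
- by move=> k; apply: leq_Nb_layer1.
- exact: leq_Nb_layer2.
- by rewrite sumnB // m'E add0n addKn.
- move=> x z l xzl; rewrite /loss_dep1 xzl.
  by rewrite ler_pM ?ler0n ?(ltW (mu_gt0 _)) // ler_nat leq_addr.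
move=> x z eqs; under eq_bigr do rewrite loss_depD.
under [leRHS]eq_bigr do rewrite loss_depD.
rewrite -mulr_sumr -natr_sum -/(st_size x) eqs natr_sum mulr_sumr.
by apply: ler_sum => k _; rewrite ler_wpM2r.
Qed.

(** With zero slack, tight means equal layer-1 counts. Packing can only suppress layer-1 departures
    and [c] bounds all rates from below, so both rate conditions hold. *)
Lemma packing_compare (c : R) (pimp : state K (Nb m n) -> R) :
  (forall k, c <= mu k) -> 0 < c ->
  stationary (mp_rate m n lam (fun=> c)) (inS m n) pimp ->
  stle pi st_sizeR pimp st_sizeR /\ amean pi <= amean pimp.
Proof.
move=> muc c_gt0 statmp.
apply: (dominated_order (c := fun=> 0%N)) => fA fB.
apply: (stationary_compare _ _ _ _ _ _ lam_ge0
  (loss_departure_rates mu_gt0) (mp_departure_rates (fun=> c_gt0)) _ _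
  (loss_stationary stat) (mp_stationary statmp)).
- by move=> k; rewrite addn0.
- by move=> k; apply: leq_Nb_layer1.
- exact: leq_Nb_layer2.
- by move=> k; apply: leq_Nb_layer1.
- exact: leq_Nb_layer2.
- by rewrite big1_eq addn0.
- move=> x z l; rewrite addn0 /loss_dep1 /mp_dep1 => ->.
  by rewrite ler_pM ?ler0n ?(ltW c_gt0) // ler_nat; case: eqP; rewrite ?mul1n.
move=> x z eqs; under eq_bigr do rewrite mp_depD.
under [leRHS]eq_bigr do rewrite loss_depD.
rewrite -mulr_sumr -natr_sum -/(st_size z) -eqs natr_sum mulr_sumr.
by apply: ler_sum => k _; rewrite ler_wpM2r.
Qed.

End Bounds.

Theorem theorem8 (R : rcfType) (K : nat) (m : 'I_K -> nat) (n : nat)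
  (lam mu : 'I_K -> R) :
  (0 < K)%N -> (forall k, 0 < lam k) -> (forall k, 0 < mu k) ->
  forall pi : state K (Nb m n) -> R,
  stationary (loss_rate m n lam mu) (inS m n) pi ->
  forall pimp : state K (Nb m n) -> R,
  stationary (mp_rate m n lam (fun _ => mu_min mu)) (inS m n) pimp ->
  (forall m' : 'I_K -> nat, inC m n m' ->
   forall pi' : state K (Nb m' 0) -> R,
   stationary (loss_rate m' 0 lam (fun _ => mu_max mu)) (inS m' 0) pi' ->
     [/\ stle pi' st_sizeR pi st_sizeR,
         amean pi' <= amean pi,
         (r_mu mu)^-1 * thr (fun _ => mu_max mu) pi' <= thr mu pi
       & blk m n lam pi <= 1 - (r_mu mu)^-1 * (1 - blk m' 0 lam pi')])
  /\ [/\ stle pi st_sizeR pimp st_sizeR,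
         amean pi <= amean pimp,
         thr mu pi <= r_mu mu * thr (fun _ => mu_min mu) pimp
       & 1 - r_mu mu * (1 - blk m n lam pimp) <= blk m n lam pi].
Proof.
move=> K_gt0 lam_gt0 mu_gt0 pi stat pimp statmp.
have min_gt0 := mu_min_gt0 K_gt0 mu_gt0; have max_gt0 := mu_max_gt0 K_gt0 mu_gt0.
have [pi_ge0 _ _ _] := stat.
have Lam_gt0 : 0 < \sum_k lam k.
  rewrite (bigD1 (Ordinal K_gt0)) //= ltr_pwDl //.
  by apply: sumr_ge0 => k _; apply: ltW.
have blk_pi := blkE (leq_Nb_layer1 m n) (leq_Nb_layer2 m n)
  (loss_departure_rates mu_gt0) (loss_depD mu) (loss_stationary stat) Lam_gt0.
split=> [m' m'C pi' stat'|].
  have [le_st le_a] := dedicated_compare lam_gt0 mu_gt0 stat (mu_le_max mu) max_gt0 m'C stat'.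
  have le_thr : (r_mu mu)^-1 * thr (fun=> mu_max mu) pi' <= thr mu pi.
    (* The factor [r_mu^-1] turns [mu_max] into [mu_min], and [mu_min] times the mean size is at
       most the throughput. *)
    rewrite thr_const /r_mu invf_div mulrA divfK ?gt_eqF //.
    apply: le_trans (amean_le_thr (mu_min_le mu) pi_ge0).
    by rewrite ler_pM2l.
  split=> //; rewrite blk_pi.
  rewrite (blkE (leq_Nb_layer1 m' 0) (leq_Nb_layer2 m' 0)
    (loss_departure_rates (fun=> max_gt0)) (loss_depD _) (loss_stationary stat') Lam_gt0).
  (* By [blkE], one minus the blocking probability is throughput over total arrival rate, so this is
     [le_thr] divided by that rate. *)
  by rewrite lerD2l lerN2 opprB addrC subrK mulrA ler_pM2r ?invr_gt0.
have [le_st le_a] := packing_compare lam_gt0 mu_gt0 stat (mu_min_le mu) min_gt0 statmp.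
have le_thr : thr mu pi <= r_mu mu * thr (fun=> mu_min mu) pimp.
  rewrite thr_const /r_mu mulrA divfK ?gt_eqF //.
  apply: le_trans (thr_le_amean (mu_le_max mu) pi_ge0) _.
  by rewrite ler_pM2l.
split=> //; rewrite blk_pi.
rewrite (blkE (leq_Nb_layer1 m n) (leq_Nb_layer2 m n)
  (mp_departure_rates (fun=> min_gt0)) (mp_depD _) (mp_stationary statmp) Lam_gt0).
by rewrite lerD2l lerN2 opprB addrC subrK mulrA ler_pM2r ?invr_gt0.
Qed.
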